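(* Let $\alpha$ be a unit interval parking function of length $n$ and let $b_1\,|\,b_2\,|\,\cdots\,|\,b_m$ be its block structure. Then $\alpha$ is a unit Fubini ranking if and only if $|b_j|\le 2$ for every $j\in[m]$.
   Context: $[n]=\{1,\ldots,n\}$. Parking process: $\alpha=(a_1,\ldots,a_n)\in[n]^n$ encodes preferences of cars $1,\ldots,n$ arriving in order at a one-way street with spots $1,\ldots,n$; car $i$ parks in spot $a_i$ if free, otherwise in the first free spot after $a_i$, if any. $\alpha$ is a parking function if all cars park (equivalently, its weakly increasing rearrangement $\alpha'=(a'_1,\ldots,a'_n)$ satisfies $a'_i\le i$ for all $i$). A unit interval parking function is a parking function in which each car $i$ parks in spot $a_i$ or $a_i+1$. A Fubini ranking is a tuple $(r_1,\ldots,r_n)\in[n]^n$ with $r_i=1+|\{j:r_j<r_i\}|$ for all $i$ (a ranking of competitors with ties, where $m$ competitors tied at rank $r$ make ranks $r+1,\ldots,r+m-1$ unused). A unit Fubini ranking is a tuple that is both a Fubini ranking and a unit interval parking function. Block structure: for a unit interval parking function $\alpha$ with weakly increasing rearrangement $\alpha'$, let $i_1<i_2<\cdots<i_m$ be all indices with $a'_{i_j}=i_j$, and set $i_{m+1}=n+1$; the blocks are $b_j=(a'_{i_j},a'_{i_j+1},\ldots,a'_{i_{j+1}-1})$, and $\alpha'$ is their concatenation $b_1|b_2|\cdots|b_m$. *)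

(* Defs.v *)
From mathcomp Require Import all_boot.

Set Implicit Arguments.
Unset Strict Implicit.
Unset Printing Implicit Defensive.

(* Spots, cars and preferences are numbered from 1 as in [n] = {1, ..., n};
   tuple positions ('I_n, nth) are numbered from 0, so car i is position i.-1. *)

Definition preferences n (alpha : n.-tuple nat) : Prop :=
  forall i : 'I_n, 1 <= tnth alpha i <= n.

(* The first spot s with a <= s <= n that is not in occ, if there is one. *)
Definition first_free (n : nat) (occ : seq nat) (a : nat) : option nat :=
  ohead [seq s <- iota a (n.+1 - a) | s \notin occ].

(* Spots obtained by the successive cars with preferences alpha when the spots
   in occ are already taken; None is for a car that leaves without parking. *)
Fixpoint park_from (n : nat) (occ alpha : seq nat) : seq (option nat) :=
  if alpha is a :: alpha' then
    let p := first_free n occ a in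
    p :: park_from n (if p is Some s then s :: occ else occ) alpha'
  else [::].

Definition outcome n (alpha : n.-tuple nat) (i : 'I_n) : option nat :=
  nth None (park_from n [::] alpha) i.

Definition parking_function n (alpha : n.-tuple nat) : Prop :=
  preferences alpha /\ forall i : 'I_n, outcome alpha i <> None.

Definition unit_interval_parking_function n (alpha : n.-tuple nat) : Prop :=
  parking_function alpha /\
  forall i : 'I_n, outcome alpha i = Some (tnth alpha i) \/
                   outcome alpha i = Some (tnth alpha i + 1).

Definition fubini_ranking n (r : n.-tuple nat) : Prop :=
  preferences r /\
  forall i : 'I_n, tnth r i = 1 + #|[set j : 'I_n | tnth r j < tnth r i]|.

Definition unit_fubini_ranking n (alpha : n.-tuple nat) : Prop :=
  fubini_ranking alpha /\ unit_interval_parking_function alpha.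

Definition rearrangement n (alpha : n.-tuple nat) : seq nat := sort leq alpha.

(* i_1 < ... < i_m: the 1-based indices i with a'_i = i. *)
Definition block_starts n (alpha : n.-tuple nat) : seq nat :=
  [seq i <- iota 1 n | nth 0 (rearrangement alpha) i.-1 == i].

(* (x_i, ..., x_(k-1)), with 1-based indices. *)
Definition slice (x : seq nat) (i k : nat) : seq nat :=
  take (k - i) (drop i.-1 x).

(* b_1, ..., b_m: the pairs (i_j, i_(j+1)), with i_(m+1) = n + 1, are obtained
   by zipping i_1, ..., i_m with i_2, ..., i_m, n + 1. *)
Definition blocks n (alpha : n.-tuple nat) : seq (seq nat) :=
  let starts := block_starts alpha in
  [seq slice (rearrangement alpha) p.1 p.2
     | p <- zip starts (rcons (behead starts) n.+1)].

(* Main.v *)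
Require Import Defs.
From mathcomp Require Import all_boot.
From mathcomp Require Import zify.

(** Every spot s is taken by exactly one car, whose preference is s or s - 1.
    Counting cars by spot and by preference, the rearrangement satisfies
    a'_i = i (block start) or a'_i = i - 1, so a block starting at i reads
    i, i, i + 1, i + 2, ...  A value v occurring in a' obeys the Fubini condition
    iff its first occurrence is at position v; this fails exactly for the third
    and later entries of a block.  Hence both sides of the equivalence say that
    two consecutive positions are never both different from block starts. *)

(** * Parking process: occupied spots are never reused *)

Lemma first_free_Some {n occ a x} :
  first_free n occ a = Some x -> x \notin occ /\ x <= n.
Proof.
rewrite /first_free => E.
have : x \in [seq s <- iota a (n.+1 - a) | s \notin occ].
  by case: filter E => //= y l [->]; rewrite mem_head.
rewrite mem_filter mem_iota => /andP[-> H]; split=> //; lia.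
Qed.

Lemma park_from_Some {n occ l i x} :
  nth None (park_from n occ l) i = Some x -> x \notin occ /\ x <= n.
Proof.
elim: l occ i => [|a l IH] occ [|i] //=; first exact: first_free_Some.
move=> /IH[H1 H2]; split=> //; apply: contra H1 => xo.
by case: first_free => // s; rewrite inE xo orbT.
Qed.

(** Once taken, a spot stays in [occ] for all later cars. *)
Lemma park_from_inj {n occ l i j x} : i < j ->
  nth None (park_from n occ l) i = Some x ->
  nth None (park_from n occ l) j <> Some x.
Proof.
elim: l occ i j => [|a l IH] occ [|i] [|j] //= ij; last exact: IH.
by move=> -> /park_from_Some[]; rewrite mem_head.
Qed.

(** * Sorted sequences: position against counts *)

Lemma sorted_nth_count_leq {s k} : sorted leq s -> k < size s ->
  k < count (fun x => x <= nth 0 s k) s.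
Proof.
move=> ss ks; rewrite -{2}(cat_take_drop k.+1 s) count_cat.
suff: all (fun x => x <= nth 0 s k) (take k.+1 s).
  by rewrite all_count => /eqP ->; rewrite size_takel // leq_addr.
apply/(all_nthP 0) => i; rewrite size_takel // => ik.
rewrite nth_take //.
by apply: (sorted_leq_nth leq_trans leqnn) => //; rewrite inE; lia.
Qed.

Lemma sorted_nth_count_ltn {s k} : sorted leq s -> k < size s ->
  count (fun x => x < nth 0 s k) s <= k.
Proof.
move=> ss ks; rewrite -{2}(cat_take_drop k s) count_cat.
suff: ~~ has (fun x => x < nth 0 s k) (drop k s).
  rewrite has_count -eqn0Ngt => /eqP ->.
  by rewrite addn0 (leq_trans (count_size _ _)) // size_takel // ltnW.
apply/(has_nthP 0) => -[i]; rewrite size_drop nth_drop => ik.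
apply/negP; rewrite -leqNgt.
by apply: (sorted_leq_nth leq_trans leqnn) => //; rewrite ?inE; lia.
Qed.

(** * Successive elements of an increasing list, closed off by [N] *)

Lemma zip_next_le {N a l x y} : path ltn a l -> all (fun z => z < N) (a :: l) ->
  (x, y) \in zip (a :: l) (rcons l N) ->
  [/\ x \in a :: l, y <= N & forall z, z \in a :: l -> x < z -> y <= z].
Proof.
elim: l a => [|b l IH] a /=.
  move=> _ _; rewrite inE => /eqP[-> ->]; split=> [||z]; rewrite ?inE //.
  by move=> /eqP ->; rewrite ltnn.
move=> /andP[ab pl] /and3P[aN bN lN]; rewrite inE => /orP[/eqP[-> ->]|xy].
  split=> [||z]; rewrite ?mem_head ?(ltnW bN) // !inE.
  case/or3P=> [/eqP->|/eqP->|zl] az //; first by rewrite ltnn in az.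
  by rewrite ltnW //; move/(order_path_min ltn_trans)/allP: pl; apply.
have [|xl yN Hy] := IH b pl _ xy; first by rewrite /= bN.
split=> // [|z]; first by rewrite inE xl orbT.
rewrite inE => /orP[/eqP-> xa|]; last exact: Hy.
have bx : b <= x.
  move: xl; rewrite inE => /orP[/eqP->//|xl].
  by rewrite ltnW //; move/(order_path_min ltn_trans)/allP: pl; apply.
by move: ab bx xa => /=; lia.
Qed.

Lemma zip_next_exists {N a l x} : path ltn a l -> all (fun z => z < N) (a :: l) ->
  x \in a :: l ->
  exists y, [/\ (x, y) \in zip (a :: l) (rcons l N), x < y & y = N \/ y \in a :: l].
Proof.
elim: l a => [|b l IH] a /=.
  move=> _ /andP[aN _]; rewrite inE => /eqP->; exists N.
  by split; rewrite ?mem_head //; left.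
move=> /andP[ab pl] /and3P[aN bN lN]; rewrite inE => /orP[/eqP->|xl].
  by exists b; split; rewrite ?mem_head //; right; rewrite !inE eqxx orbT.
have [|y [xy xly yl]] := IH b pl _ xl; first by rewrite /= bN.
exists y; split=> //; first by rewrite inE xy orbT.
by case: yl => [|yl]; [left|right; rewrite inE yl orbT].
Qed.

Lemma count_tnth n (t : n.-tuple nat) (P : pred nat) :
  count P t = count (fun i => P (tnth t i)) (enum 'I_n).
Proof. by rewrite -{1}(map_tnth_enum t) count_map. Qed.

(** Membership and counts are invariant under sorting, so in this form the condition can be tested
    on the rearrangement. *)
Lemma fubini_rankingP n (r : n.-tuple nat) : preferences r ->
  fubini_ranking r <-> forall v, v \in r -> v = (count (fun x => x < v) r).+1.
Proof.
move=> pr.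
have E v : #|[set j : 'I_n | tnth r j < v]| = count (fun x => x < v) r.
  rewrite count_tnth cardE enumT /enum_mem size_filter.
  by apply: eq_count => j; rewrite /= inE.
split=> [[_ H] v /tnthP[i ->]|H]; first by rewrite -E -add1n -H.
by split=> // i; rewrite E add1n -H // mem_tnth.
Qed.

(** * Spots and preferences of a unit interval parking function *)

Section UnitInterval.

Variables (n : nat) (alpha : n.-tuple nat).
Hypothesis halpha : unit_interval_parking_function alpha.

(** The default 0 is never reached, since every car parks. *)
Let spot (i : 'I_n) := odflt 0 (outcome alpha i).

Lemma outcome_spot i : outcome alpha i = Some (spot i).
Proof.
by rewrite /spot; case: halpha => _ /(_ i) [] ->.
Qed.

Lemma spot_bounds i : tnth alpha i <= spot i <= (tnth alpha i).+1.
Proof.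
rewrite /spot; case: halpha => _ /(_ i) [] -> /=; lia.
Qed.

Lemma spot_inj : injective spot.
Proof.
move=> i j E; apply/val_inj; move: (outcome_spot i) (outcome_spot j).
rewrite E /outcome => Hi Hj.
by case: (ltngtP i j) => // ij; [case: (park_from_inj ij Hi)|case: (park_from_inj ij Hj)].
Qed.

(** Pigeonhole: n distinct spots within [n] exhaust [n]. *)
Lemma perm_spots : perm_eq [seq spot i | i <- enum 'I_n] (iota 1 n).
Proof.
have us : uniq [seq spot i | i <- enum 'I_n].
  by rewrite map_inj_uniq ?enum_uniq //; exact: spot_inj.
apply: uniq_perm (iota_uniq _ _) _ => //.
apply: (uniq_min_size us _ _).2; last by rewrite size_iota size_map size_enum_ord.
move=> x /mapP[i _ ->]; rewrite mem_iota.
have [_] := park_from_Some (outcome_spot i).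
case: halpha => -[/(_ i) pi _] _; move: pi (spot_bounds i); lia.
Qed.

Lemma count_spot_leq {m} : m <= n -> count (fun i => spot i <= m) (enum 'I_n) = m.
Proof.
move=> mn.
have -> : count (fun i => spot i <= m) (enum 'I_n)
        = count (fun x => x <= m) [seq spot i | i <- enum 'I_n].
  by rewrite count_map.
rewrite (permP perm_spots) -(subnKC mn) iotaD count_cat.
have -> : count (leq^~ m) (iota 1 m) = m.
  rewrite -[RHS](size_iota 1); apply/eqP; rewrite -all_count.
  by apply/allP => x; rewrite mem_iota add1n ltnS => /andP[].
have -> : count (leq^~ m) (iota (1 + m) (n - m)) = 0.
  apply/eqP; rewrite eqn0Ngt -has_count; apply/hasPn => x.
  by rewrite mem_iota -ltnNge => /andP[].
exact: addn0.
Qed.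

(** The v cars in spots 1, ..., v do not prefer later spots. *)
Lemma count_pref_ltn {v} : v <= n -> v <= count (fun x => x < v.+1) alpha.
Proof.
move=> vn; rewrite -{1}(count_spot_leq vn) count_tnth; apply: sub_count => i /=.
by have := spot_bounds i; lia.
Qed.

(** Cars preferring at most v end up in spots 1, ..., v + 1. *)
Lemma count_pref_leq v : count (fun x => x <= v) alpha <= v.+1.
Proof.
case: (leqP n v.+1) => vn.
  by rewrite (leq_trans (count_size _ _)) // size_tuple.
rewrite -(count_spot_leq (ltnW vn)) count_tnth; apply: sub_count => i /=.
by have := spot_bounds i; lia.
Qed.

Local Notation s := (rearrangement alpha).

Lemma size_rearrangement : size s = n.
Proof. by rewrite size_sort size_tuple. Qed.

Lemma sorted_rearrangement : sorted leq s.
Proof. exact: (sort_sorted leq_total). Qed.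

Lemma count_rearrangement P : count P s = count P alpha.
Proof. by rewrite count_sort. Qed.

(** Let v be the entry at 0-based index k. Between k + 1 and v + 1 preferences are at most v, so k
    <= v; at least v - 1 and at most k are below v, so v <= k + 1. *)
Lemma rearrangement_bounds {k} : k < n -> 0 < nth 0 s k /\ k <= nth 0 s k <= k.+1.
Proof.
move=> kn; have ks : k < size s by rewrite size_rearrangement.
have : nth 0 s k \in alpha by rewrite -(mem_sort leq) mem_nth.
case/tnthP=> i Ei; have /andP[] := halpha.1.1 i.
rewrite -Ei => v0 vn.
have H1 := sorted_nth_count_leq sorted_rearrangement ks.
have H2 := sorted_nth_count_ltn sorted_rearrangement ks.
rewrite !count_rearrangement in H1 H2.
have H3 := count_pref_leq (nth 0 s k).
have H4 : (nth 0 s k).-1 <= count (fun x => x < nth 0 s k) alpha.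
  by rewrite -{2}(prednK v0); apply: count_pref_ltn; lia.
split=> //; lia.
Qed.

(** * Both conditions in terms of block starts *)

Lemma mem_block_starts i :
  (i \in block_starts alpha) = [&& 0 < i, i <= n & nth 0 s i.-1 == i].
Proof. by rewrite mem_filter mem_iota add1n ltnS andbC -andbA. Qed.

Lemma fubini_rankingP_starts :
  fubini_ranking alpha <-> forall i, 0 < i < n ->
    (i \in block_starts alpha) || (i.+1 \in block_starts alpha).
Proof.
have [[pr _] _] := halpha; rewrite fubini_rankingP //; split=> H.
- move=> i /andP[i0 lt_in]; rewrite !mem_block_starts i0 lt_in (ltnW lt_in) /=.
  apply/orP; case: eqP => [|A]; [by left|right; apply/eqP].
  have i1n : i.-1 < n by lia.
  have [_ B] := rearrangement_bounds i1n.
  have [_ C] := rearrangement_bounds lt_in.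
  (* If a'_(i+1) = i, the value i occurs, so the Fubini condition allows only i - 1 entries below i;
     but a'_i = i - 1 forces at least i of them. *)
  case: (eqVneq (nth 0 s i) i) => [E|]; last by lia.
  have ia : i \in alpha.
    by rewrite -(mem_sort leq) -{1}E mem_nth // size_rearrangement.
  have Hi := H i ia.
  have i1s : i.-1 < size s by rewrite size_rearrangement.
  have D := sorted_nth_count_leq sorted_rearrangement i1s.
  rewrite count_rearrangement in D.
  have F : nth 0 s i.-1 = i.-1 by lia.
  have G : count (fun x => x <= nth 0 s i.-1) alpha = count (fun x => x < i) alpha.
    by apply: eq_count => x; rewrite F; lia.
  lia.
(* At a start a'_i = i, sortedness gives at most i - 1 smaller entries and [count_pref_ltn] at least
   i - 1. *)
- have K i : i \in block_starts alpha -> i = (count (fun x => x < i) alpha).+1.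
    rewrite mem_block_starts => /and3P[i0 le_in /eqP E].
    have i1s : i.-1 < size s by rewrite size_rearrangement; lia.
    have A := sorted_nth_count_ltn sorted_rearrangement i1s.
    rewrite count_rearrangement E in A.
    have i1n : i.-1 <= n by lia.
    have B := count_pref_ltn i1n.
    rewrite (prednK i0) in B; lia.
  move=> v; rewrite -(mem_sort leq) => /(nthP 0)[k]; rewrite size_rearrangement.
  move=> kn E; apply: K; have [v0 A] := rearrangement_bounds kn.
  change (nth 0 s k = v) in E; rewrite E in v0 A.
  case: (eqVneq v k.+1) => [Ev|nv].
    by rewrite Ev in E *; rewrite mem_block_starts kn /= E.
  (* Here a'_(v+1) = v, so v + 1 is not a start and [H] makes v one. *)
  have vk : v = k by lia.
  have /H/orP[] : 0 < v < n by lia.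
    by [].
  by rewrite (mem_block_starts v.+1) /= vk E => /andP[_ /eqP]; lia.
Qed.

Lemma blocks_le2P :
  (forall j, j < size (blocks alpha) -> size (nth [::] (blocks alpha) j) <= 2) <->
  forall i, 0 < i < n ->
    (i \in block_starts alpha) || (i.+1 \in block_starts alpha).
Proof.
have : sorted ltn (block_starts alpha).
  by apply: sorted_filter ltn_trans _ _ (iota_ltn_sorted _ _).
have : all (fun z => z < n.+1) (block_starts alpha).
  by apply/allP => z; rewrite mem_block_starts ltnS => /and3P[].
have start1 : 0 < n -> 1 \in block_starts alpha.
  by move=> n0; rewrite mem_block_starts n0 /=; have [] := rearrangement_bounds n0; lia.
have -> : (forall j, j < size (blocks alpha) -> size (nth [::] (blocks alpha) j) <= 2)
   <-> {in blocks alpha, forall b, size b <= 2}.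
  split=> [H b /(nthP [::])[j jb <-]|H j jb]; first exact: H.
  by apply: H; rewrite mem_nth.
have size_slice x y : 0 < x <= n -> y <= n.+1 -> size (slice s x y) = y - x.
  move=> x0 yn; rewrite /slice size_take size_drop size_rearrangement.
  by case: ltnP; lia.
rewrite /blocks; move: size_slice start1 (mem_block_starts).
case: (block_starts alpha) => [|a l] size_slice start1 mem_st ltN lt_st.
  (* With no starts, n = 0 and both sides are vacuous. *)
  by split=> // _ i ?; have := start1 ltac:(lia).
split=> H.
- have next x : x \in a :: l ->
      exists2 y, x < y <= x.+2 & y = n.+1 \/ y \in a :: l.
    move=> xl; have [y [xy lt_xy yl]] := zip_next_exists lt_st ltN xl.
    exists y => //; have [_ yn _] := zip_next_le lt_st ltN xy.
    have := H _ (map_f (fun p => slice s p.1 p.2) xy).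
    move: xl; rewrite mem_st => /and3P[x0 xn _] /=.
    by rewrite size_slice ?x0 //; lia.
  (* Induction from the start 1: if i is a start, the next one is i + 1 or i + 2, because the end n
     + 1 is still too far away. *)
  elim=> // i IH /= i1n; case: (posnP i) => [->|i0]; first by rewrite start1 //; lia.
  have /IH/orP[il|->//] : 0 < i < n by lia.
  have [y y2 [Ey|yl]] := next i il; first by lia.
  have [Ey|Ey] : y = i.+1 \/ y = i.+2 by lia.
    by rewrite -Ey yl.
  by rewrite -Ey yl orbT.
- move=> b /mapP[[x y] xy ->] /=.
  have [xl yn Hy] := zip_next_le lt_st ltN xy.
  have := xl; rewrite mem_st => /and3P[x0 xn _].
  rewrite size_slice ?x0 //.
  (* Either the end n + 1 is within 2 of x, or [H] at x + 1 provides a start within 2 of x, which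
     bounds y. *)
  case: (leqP n x.+1) => x1n; first by lia.
  have /H/orP[/Hy|/Hy] : 0 < x.+1 < n by lia.
    by lia.
  by lia.
Qed.

End UnitInterval.

Theorem theorem3p5 (n : nat) (alpha : n.-tuple nat)
    (halpha : unit_interval_parking_function alpha) :
  unit_fubini_ranking alpha <->
  (forall j : nat, j < size (blocks alpha) ->
     size (nth [::] (blocks alpha) j) <= 2).
Proof.
rewrite (blocks_le2P _ _ halpha) -(fubini_rankingP_starts _ _ halpha).
by split=> [[]|].
Qed.
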